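(* Let $\rho>0$ and consider the control system $\Sigma_{\mathcal{C}_H}$ on $\mathcal{C}_H=\mathbb{R}\times\mathbb{R}/\mathbb{Z}$ given by $\dot{x}=u$, $\dot{[y]}=e^{x}-1$, $u\in\Omega=[-\rho,\rho]$. Then there exist points $P_0,P_1\in\mathcal{C}_H$ with two distinct minimal-time trajectories of $\Sigma_{\mathcal{C}_H}$ connecting $P_0$ to $P_1$.
   Context: Here $[y]\in\mathbb{R}/\mathbb{Z}$ denotes the class of $y\in\mathbb{R}$. Admissible controls are the piecewise constant functions $\mathbf{u}$ with values in $\Omega=[-\rho,\rho]$; the set of them is $\mathcal{U}$. For $P\in\mathcal{C}_H$ and $\mathbf{u}\in\mathcal{U}$, $t\mapsto\phi(t,P,\mathbf{u})$ is the continuous, piecewise differentiable curve in $\mathcal{C}_H$ solving the system with control $\mathbf{u}$ and $\phi(0,P,\mathbf{u})=P$. A minimal-time trajectory connecting $P_0$ to $P_1$ is a solution curve $t\in[0,T]\mapsto\phi(t,P_0,\mathbf{u})$ with $\phi(T,P_0,\mathbf{u})=P_1$ such that $T$ is smallest among all $T'\geq0$ for which some $\mathbf{u}'\in\mathcal{U}$ satisfies $\phi(T',P_0,\mathbf{u}')=P_1$. *)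

(* Defs.v *)
From HB Require Import structures.
From mathcomp Require Import all_boot all_order all_algebra.
From mathcomp Require Import all_classical all_reals all_analysis.

Set Implicit Arguments.
Unset Strict Implicit.
Unset Printing Implicit Defensive.

Import Order.TTheory GRing.Theory Num.Theory.
Import numFieldNormedType.Exports.

Local Open Scope classical_set_scope.
Local Open Scope ring_scope.
Local Open Scope quotient_scope.

Definition int_pred (R : realType) : {pred R} := fun x => x \is a Num.int.

Lemma int_pred_zmod_closed (R : realType) : zmod_closed (@int_pred R).
Proof. by split=> [|x y]; [exact: rpred0 | exact: rpredB]. Qed.

HB.instance Definition _ (R : realType) :=
  GRing.isZmodClosed.Build R (@int_pred R) (@int_pred_zmod_closed R).

Definition circle (R : realType) : Type :=
  quotient_topology (Quotient.quot (@int_pred R)).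
HB.instance Definition _ (R : realType) := Topological.on (circle R).
HB.instance Definition _ (R : realType) := Quotient.on (circle R).

Definition circle_class (R : realType) (y : R) : circle R := \pi_(circle R) y.

Definition cylinder (R : realType) : Type := (R * circle R)%type.
HB.instance Definition _ (R : realType) := Topological.on (cylinder R).

(* Derivatives of curves in R/Z are taken in the charts given by local
   sections of y |-> [y], i.e. through a lift to R defined near t. *)
Definition circle_is_derive (R : realType) (g : R -> circle R) (t v : R) : Prop :=
  exists h : R -> R,
    (\forall s \near t, g s = circle_class (h s)) /\ is_derive t (1 : R) h v.

Definition cylinder_is_derive (R : realType) (c : R -> cylinder R) (t : R)
    (v : R * R) : Prop :=
  is_derive t (1 : R) (fun s => (c s).1) v.1 /\
  circle_is_derive (fun s => (c s).2) t v.2.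

Definition vector_field (R : realType) (P : cylinder R) (w : R) : R * R :=
  (w, expR P.1 - 1).

(* Finitely many pieces on every bounded interval; each piece is open, so the
   values of u at the switching times are arbitrary. *)
Definition piecewise_constant (R : realType) (u : R -> R) : Prop :=
  forall a b : R, a < b ->
    exists s : seq R, itv_partition a b s /\
      forall i, (i < size s)%N -> exists w : R,
        {in `]nth b (a :: s) i, nth b (a :: s) i.+1[, u =1 cst w}.

Definition admissible_control (R : realType) (rho : R) (u : R -> R) : Prop :=
  piecewise_constant u /\ forall t, u t \in `[- rho, rho].

(* c is the curve t |-> phi(t, P, u).  For piecewise constant u, the
   continuity points of u are the points near which u is constant; elsewhere
   (a locally finite set) c need not be differentiable. *)
Definition solution_curve (R : realType) (P : cylinder R) (u : R -> R)
    (c : R -> cylinder R) : Prop :=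
  [/\ continuous c, c 0 = P &
      forall t, {for t, continuous u} ->
        cylinder_is_derive c t (vector_field (c t) (u t))].

Definition trajectory (R : realType) (rho : R) (P0 P1 : cylinder R) (T : R)
    (c : R -> cylinder R) : Prop :=
  [/\ 0 <= T, c T = P1 &
      exists2 u, admissible_control rho u & solution_curve P0 u c].

(* Only the restriction of c to [0, T] is meaningful: two trajectories with
   the same final time T are distinct when they differ on [0, T]. *)
Definition minimal_time_trajectory (R : realType) (rho : R)
    (P0 P1 : cylinder R) (T : R) (c : R -> cylinder R) : Prop :=
  trajectory rho P0 P1 T c /\
  forall T' c', trajectory rho P0 P1 T' c' -> T <= T'.

(* Main.v *)
Require Import Defs.
From HB Require Import structures.
From mathcomp Require Import all_boot all_order all_algebra.
From mathcomp Require Import all_classical all_reals all_analysis.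
From mathcomp Require Import ring lra zify.

Import Order.TTheory GRing.Theory Num.Theory.
Import numFieldNormedType.Exports.

Local Open Scope classical_set_scope.
Local Open Scope ring_scope.

(** Lift y from R/Z to R. To go from x = 0 back to x = 0 in time T = 2 tau, a
    trajectory can push x away from 0 at full speed [r = rho] or [r = - rho]
    until tau and then return at full speed; x then follows a tent, and y
    changes by [2 * climb r tau]. Since the speed of x is at most rho, the
    x-coordinate of any trajectory that returns to 0 at time T lies between the
    two tents; since y' = e^x - 1 increases with x, the change of the lifted y
    lies in the interval
    I(T) = [2 * climb (- rho) tau, 2 * climb rho tau] ([reach_bound]).
    These intervals grow strictly with T ([lt_climb]), starting from {0}.

    Take T such that I(T) has length exactly 1 ([exists_half_time]). Then the two
    end points of I(T) are the same point of the circle, so both bang-bang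
    trajectories go from (0, [0]) to the same P1 in time T, one around each side
    of the cylinder. For T' < T the interval I(T') is contained in the interior
    of I(T), which contains no lift of P1: no trajectory is faster. The two
    trajectories differ at time tau, where x is rho tau and - rho tau.

    The remaining work is the passage from the circle to its lift
    ([solution_curve_lift]) and the neglect of the switching times, at which a
    solution need not be differentiable ([le_piecewise_constant]). *)

(** * Monotonicity across switching times *)

Lemma le_itv_partition {R : realType} (f : R -> R) (a b : R) (s : seq R) :
  itv_partition a b s ->
  (forall t : R, a <= t <= b -> {for t, continuous f}) ->
  (forall i t, (i < size s)%N ->
    t \in `]nth b (a :: s) i, nth b (a :: s) i.+1[ ->
    exists2 d, is_derive t (1 : R) f d & 0 <= d) ->
  f a <= f b.
Proof.
elim: s a => [|x s ih] a; first by move=> /itv_partition_nil ->.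
move=> abs cf df.
have xbs := itv_partition_cons abs.
have xb := itv_partition_le xbs.
have ax : a < x by case: abs => /= /andP[].
apply: (@le_trans _ _ (f x)).
  have df0 t : t \in `]a, x[ -> exists2 d, is_derive t (1 : R) f d & 0 <= d.
    exact: (df 0%N).
  apply: (@ger0_derive1_ndecr _ f a x) => //.
  - by move=> t /df0[d []].
  - by move=> t /df0[d [_ fd]]; rewrite derive1E fd.
  - apply: continuous_in_subspaceT => t; rewrite inE/= in_itv/= => /andP[at' tx].
    by apply: cf; rewrite at' (le_trans tx).
  - exact: ltW.
apply: (ih x) => //.
- move=> t /andP[xt tb]; apply: cf; rewrite tb andbT.
  by rewrite (le_trans (ltW ax)).
- by move=> i t si; exact: (df i.+1).
Qed.

(** A piecewise constant function is continuous inside each of its pieces, so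
    the hypothesis on the derivative leaves out finitely many times only, and
    there the continuity of [f] lets the inequalities of adjacent pieces be
    chained. *)
Lemma le_piecewise_constant {R : realType} (u f : R -> R) (a b : R) :
  piecewise_constant u -> a <= b ->
  (forall t : R, a <= t <= b -> {for t, continuous f}) ->
  (forall t : R, a < t < b -> {for t, continuous u} ->
    exists2 d, is_derive t (1 : R) f d & 0 <= d) ->
  f a <= f b.
Proof.
move=> pu; rewrite le_eqVlt => /predU1P[-> //|ab] cf df.
have [s [abs us]] := pu a b ab.
apply: (le_itv_partition _ _ _ _ abs) => // i t si tI.
have [w uw] := us i si.
have /andP[lt rt] : nth b (a :: s) i < t < nth b (a :: s) i.+1.
  by rewrite in_itv in tI.
apply: df.
  rewrite (le_lt_trans _ lt)/=; last first.
    by apply: (itv_partition_nth_ge _ abs); exact: ltnW.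
  by rewrite (lt_le_trans rt)//; exact: (itv_partition_nth_le _ abs).
apply: cvg_near_cst; apply: filterS (near_in_itvoo tI) => x xI.
by rewrite !uw.
Qed.

Lemma piecewise_constant_derive0 {R : realType} (u f : R -> R) (a b : R) :
  piecewise_constant u -> a <= b ->
  (forall t : R, a <= t <= b -> {for t, continuous f}) ->
  (forall t : R, a < t < b -> {for t, continuous u} -> is_derive t (1 : R) f 0) ->
  f a = f b.
Proof.
move=> pu ab cf df; apply/eqP; rewrite eq_le; apply/andP; split.
  apply: (le_piecewise_constant u f a b) => // t tab cu.
  by exists 0; first exact: df.
rewrite -lerN2; apply: (le_piecewise_constant u (- f) a b) => //.
  by move=> t tab; apply: continuousN; exact: cf.
move=> t tab cu; exists 0 => //; rewrite -oppr0; apply: is_deriveN; exact: df.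
Qed.

Lemma is_derive_continuous {R : realType} (f : R -> R) (t d : R) :
  is_derive t (1 : R) f d -> {for t, continuous f}.
Proof. by move=> [fd _]; apply/differentiable_continuous/derivable1_diffP. Qed.

(** The integral starts at [-1] so that the whole of [0, T] lies in the open
    domain on which the fundamental theorem of calculus differentiates it. *)
Lemma antiderivative {R : realType} (f : R -> R) (T : R) : continuous f ->
  exists F : R -> R, forall t : R, 0 <= t <= T -> is_derive t (1 : R) F (f t).
Proof.
move=> cf.
exists (fun x => \int[lebesgue_measure]_(t in [set` `[-1, x]]) (f t))%R.
move=> t /andP[t0 tT].
have [] := @continuous_FTC1_closed R f (-1) t (T + 1).
- lra.
- apply: continuous_compact_integrable; first exact: segment_compact.
  exact: continuous_subspaceT.
- lra.
- exact: cf.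
by move=> dF; rewrite derive1E => Ft; exact: DeriveDef dF Ft.
Qed.

(** * The circle R/Z *)

Lemma circle_classP {R : realType} (x y : R) :
  circle_class x = circle_class y <-> x - y \is a Num.int.
Proof.
rewrite -[_ \is a _]/(x - y \in @int_pred R) (Quotient.idealrBE (@int_pred R)).
by split=> [xy|/eqP//]; apply/eqP; exact: xy.
Qed.

Lemma circle_class_repr {R : realType} (p : circle R) : circle_class (repr p) = p.
Proof. by rewrite /circle_class reprK. Qed.

Lemma cosD_int {R : realType} (x n : R) : n \is a Num.int ->
  cos (x + pi *+ 2 * n) = cos x.
Proof.
have cosD_nat (m : nat) (y : R) : cos (y + pi *+ 2 * m%:R) = cos y.
  by rewrite mulr_natr (periodicn (@cosD2pi R)).
move/intrP => [[m|m] ->]; first exact: cosD_nat.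
by rewrite -(cosD_nat m.+1) NegzE rmorphN/= mulrN subrK.
Qed.

(** With [y] the fractional part of [x], cos (2 pi y) = 1 forces
    sin (pi y) = 0, whereas sin is positive on ]0, pi[. *)
Lemma cos_eq1_int {R : realType} (x : R) :
  cos (pi *+ 2 * x) = 1 -> x \is a Num.int.
Proof.
move=> cx1; pose y := x - (Num.floor x)%:~R.
have y0 : 0 <= y by rewrite subr_ge0 floor_le_tmp.
have y1 : y < 1 by rewrite ltrBlDl; have := floorD1_gt x; rewrite intrD.
suff : y = 0 by move/eqP; rewrite subr_eq0 => /eqP ->; rewrite intr_int.
apply/eqP; rewrite eq_le y0 andbT leNgt; apply/negP => y_gt0.
have : sin (pi * y) = 0.
  have : cos (pi *+ 2 * y) = 1.
    by rewrite -(@cosD_int _ _ (Num.floor x)%:~R) ?intr_int// -mulrDr subrK.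
  rewrite mulrnAl cos_mulr2n cos2sin2 => h.
  by apply/eqP; rewrite -sqrf_eq0; apply/eqP; lra.
have : 0 < sin (pi * y).
  by apply: sin_gt0_pi; rewrite mulr_gt0 ?pi_gt0//= gtr_pMr ?pi_gt0.
by move=> /[swap] ->; rewrite ltxx.
Qed.

(** The function induced on R/Z by a 1-periodic [f]; only for such [f] is it
    independent of the chosen representatives. *)
Definition circle_fun {R : realType} (f : R -> R) (p : circle R) : R :=
  f (repr p).

Lemma circle_fun_class {R : realType} (f : R -> R) (x : R) :
  (forall y n, n \is a Num.int -> f (y + n) = f y) ->
  circle_fun f (circle_class x) = f x.
Proof.
move=> fper; rewrite /circle_fun.
have /circle_classP/(fper x) <- := circle_class_repr (circle_class x).
by rewrite addrC subrK.
Qed.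

Lemma circle_fun_continuous {R : realType} (f : R -> R) :
  (forall y n, n \is a Num.int -> f (y + n) = f y) -> continuous f ->
  continuous (circle_fun f).
Proof.
move=> fper cf; apply/quotient_continuous.
suff -> : circle_fun f \o \pi_(circle R)%qT = f by [].
by apply/funext => x; exact: circle_fun_class.
Qed.

(** * Lifting the second coordinate *)

(** Near [t] the local lift [h] of [g] may replace its representatives, since
    cos (2 pi _) is 1-periodic, and [h - Y] has derivative 0 at [t]. *)
Lemma circle_is_derive_cos {R : realType} (g : R -> circle R) (Y : R -> R)
    (t v : R) :
  circle_is_derive g t v -> is_derive t (1 : R) Y v ->
  is_derive t (1 : R) (fun s => cos (pi *+ 2 * (repr (g s) - Y s))) 0.
Proof.
move=> [h [gh dh]] dY.
apply: (@near_eq_is_derive _ _ _ (fun s => cos (pi *+ 2 * (h s - Y s)))).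
  apply: filterS gh => s ->.
  have /circle_classP hs := circle_class_repr (circle_class (h s)).
  rewrite -(cosD_int _ _ hs); congr cos; ring.
have dhY : is_derive t (1 : R) (fun s => pi *+ 2 * (h s - Y s)) 0.
  apply: (@is_derive_eq _ _ _ ((pi *+ 2) \*: (h - Y)) _ _ _
    ((pi *+ 2) *: (v - v))).
  by rewrite subrr scaler0.
have := @is_derive1_comp _ cos _ t _ _ (is_derive_cos _) dhY.
by rewrite mulr0.
Qed.

(** The quantity cos (2 pi (y - Y)) is well defined along the curve, although
    [y] is only known modulo 1; it is continuous, has derivative 0 away from the
    switching times and equals 1 at time 0. Hence it stays 1, that is, y - Y
    stays in Z. This replaces the lifting theorem for paths in the circle. *)
Lemma solution_curve_lift {R : realType} (P : cylinder R) (u Y : R -> R)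
    (c : R -> cylinder R) (T : R) :
  piecewise_constant u -> solution_curve P u c -> 0 <= T ->
  (forall t : R, 0 <= t <= T -> is_derive t (1 : R) Y (expR (c t).1 - 1)) ->
  P.2 = circle_class (Y 0) -> (c T).2 = circle_class (Y T).
Proof.
move=> pu [cc c0 dc] T0 dY P2.
pose f s := cos (pi *+ 2 * (repr (c s).2 - Y s)).
have cosper (y n : R) : n \is a Num.int ->
    cos (pi *+ 2 * (y + n)) = cos (pi *+ 2 * y).
  by move=> ni; rewrite mulrDr cosD_int.
have sinper (y n : R) : n \is a Num.int ->
    sin (pi *+ 2 * (y + n)) = sin (pi *+ 2 * y).
  move=> ni; rewrite mulrDr.
  by rewrite -!cosBpihalf addrAC cosD_int.
have c2 : continuous (fun t => (c t).2).
  by move=> t; apply: continuous_comp; [exact: cc | exact: cvg_snd].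
have cm : continuous (fun y : R => pi *+ 2 * y) by exact: mulrl_continuous.
have cf t : 0 <= t <= T -> {for t, continuous f}.
  move=> tT.
  (* repr is not continuous on the circle: the addition formula isolates the
     periodic functions of the circle coordinate, which are. *)
  have -> : f = fun s =>
      circle_fun (fun y => cos (pi *+ 2 * y)) (c s).2 * cos (pi *+ 2 * Y s)
      + circle_fun (fun y => sin (pi *+ 2 * y)) (c s).2 * sin (pi *+ 2 * Y s).
    by apply/funext => s; rewrite /f mulrBr cosB.
  have cY : {for t, continuous (fun s => pi *+ 2 * Y s)}.
    apply: continuous_comp; last exact: cm.
    exact: is_derive_continuous (dY t tT).
  apply: continuousD; apply: continuousM.
  - apply: (@continuous_comp _ _ _ (fun t => (c t).2)); first exact: c2.
    apply: circle_fun_continuous => // y.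
    by apply: continuous_comp; [exact: cm | exact: continuous_cos].
  - apply: continuous_comp; [exact: cY | exact: continuous_cos].
  - apply: (@continuous_comp _ _ _ (fun t => (c t).2)); first exact: c2.
    apply: circle_fun_continuous => // y.
    by apply: continuous_comp; [exact: cm | exact: continuous_sin].
  - apply: continuous_comp; [exact: cY | exact: continuous_sin].
have f0T : f 0 = f T.
  apply: (piecewise_constant_derive0 u) => // t /andP[t0 tT] cu.
  have [_ /= dc2] := dc t cu.
  by apply: circle_is_derive_cos dc2 _; apply: dY; rewrite !ltW.
rewrite -[LHS]circle_class_repr; apply/circle_classP/cos_eq1_int.
rewrite -/(f T) -f0T /f c0.
have /circle_classP hi : circle_class (repr P.2) = circle_class (Y 0).
  by rewrite circle_class_repr.
by rewrite -[X in _ * X]add0r cosper// mulr0 cos0.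
Qed.

(** * Bang-bang trajectories *)

Definition switch {R : realType} {T : Type} (tau : R) (p q : R -> T)
    (t : R) : T :=
  if t < tau then p t else q t.

Lemma switch_is_derive_left {R : realType} (tau : R) (p q : R -> R) (t d : R) :
  t < tau -> is_derive t (1 : R) p d -> is_derive t (1 : R) (switch tau p q) d.
Proof.
move=> ttau; apply: near_eq_is_derive.
by apply: filterS (lt_nbhsl ttau) => s stau; rewrite /switch stau.
Qed.

Lemma switch_is_derive_right {R : realType} (tau : R) (p q : R -> R) (t d : R) :
  tau < t -> is_derive t (1 : R) q d -> is_derive t (1 : R) (switch tau p q) d.
Proof.
move=> ttau; apply: near_eq_is_derive.
have tI : t \in `]tau, +oo[ by rewrite in_itv/= ttau.
apply: filterS (near_in_itvoy tI) => s; rewrite in_itv/= andbT => stau.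
by rewrite /switch ltNge (ltW stau).
Qed.

Lemma switch_continuous {R : realType} (tau : R) (p q : R -> R) :
  p tau = q tau -> continuous p -> continuous q -> continuous (switch tau p q).
Proof.
move=> pq cp cq.
have -> : switch tau p q =
    fun t => p (Num.min t tau) + q (Num.max t tau) - p tau.
  apply/funext => t; rewrite /switch.
  by case: (ltP t tau) => ttau; [rewrite -pq addrK | rewrite addrAC subrr add0r].
move=> t; apply: cvgB; last exact: cvg_cst.
apply: cvgD.
  apply: (@continuous_comp _ _ _ (fun t => Num.min t tau)); last exact: cp.
  by apply: continuous_min; [exact: cvg_id|exact: cst_continuous].
apply: (@continuous_comp _ _ _ (fun t => Num.max t tau)); last exact: cq.
by apply: continuous_max; [exact: cvg_id|exact: cst_continuous].
Qed.

Definition bang_bang {R : realType} (tau r : R) : R -> R :=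
  switch tau (fun=> r) (fun=> - r).

(** The x-coordinate under the control [bang_bang tau r], from x = 0 at time 0
    back to x = 0 at time [2 * tau]. *)
Definition tent {R : realType} (tau r : R) : R -> R :=
  switch tau (fun t => r * t) (fun t => r * (2 * tau - t)).

(** For [r != 0], the integral of e^(r s) - 1 over [0, t], that is, the change
    of the lifted y while x leaves 0 with velocity r. *)
Definition climb {R : realType} (r t : R) : R := (expR (r * t) - 1) / r - t.

(** For [r != 0] and [0 <= tau], the integral of e^(tent tau r s) - 1 over
    [0, t]. The tent is symmetric about [tau], so the second half repeats the
    gain of the first half backwards. *)
Definition height {R : realType} (tau r : R) : R -> R :=
  switch tau (climb r) (fun t => 2 * climb r tau - climb r (2 * tau - t)).

Lemma is_derive_scale {R : realType} (r t : R) :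
  is_derive t (1 : R) (fun s => r * s) r.
Proof.
have := @is_deriveZ _ _ _ (id : R -> R) r t 1 _ (is_derive_id t 1).
by rewrite /GRing.scale/= mulr1.
Qed.

Lemma is_derive_reflect {R : realType} (a t : R) :
  is_derive t (1 : R) (fun s => a - s) (- 1).
Proof.
have := @is_deriveB _ _ _ (cst a) (id : R -> R) t 1 _ _
  (is_derive_cst _ _ _) (is_derive_id t 1).
by rewrite sub0r.
Qed.

Lemma is_derive_climb {R : realType} (r t : R) : r != 0 ->
  is_derive t (1 : R) (climb r) (expR (r * t) - 1).
Proof.
move=> r0.
have dE := @is_derive1_comp _ expR (fun s => r * s) t _ _
  (is_derive_expR _) (is_derive_scale r t).
have dF := @is_deriveZ _ _ _ _ r^-1 t 1 _
  (is_deriveB dE (is_derive_cst (1 : R) t (1 : R))).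
have := @is_deriveB _ _ _ _ (id : R -> R) t 1 _ _ dF (is_derive_id t 1).
rewrite subr0 mulrC /GRing.scale/= mulrA mulVf// mul1r.
suff -> : climb r = (r^-1 \*: ((fun s => expR (r * s)) - cst 1) - id) by [].
by apply/funext => s; rewrite /climb mulrC.
Qed.

Lemma is_derive_tent {R : realType} (tau r t : R) : t != tau ->
  is_derive t (1 : R) (tent tau r) (bang_bang tau r t).
Proof.
rewrite neq_lt => /orP[] ttau; rewrite /bang_bang /switch.
  by rewrite ttau; apply: switch_is_derive_left => //; exact: is_derive_scale.
rewrite ltNge (ltW ttau)/=; apply: switch_is_derive_right => //.
have := @is_derive1_comp _ _ _ t _ _ (is_derive_scale r _)
  (is_derive_reflect (2 * tau) t).
by rewrite mulrN1.
Qed.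

Lemma is_derive_height {R : realType} (tau r t : R) : r != 0 -> t != tau ->
  is_derive t (1 : R) (height tau r) (expR (tent tau r t) - 1).
Proof.
move=> r0; rewrite neq_lt => /orP[] ttau; rewrite /tent /switch.
  by rewrite ttau; apply: switch_is_derive_left => //; exact: is_derive_climb.
rewrite ltNge (ltW ttau)/=; apply: switch_is_derive_right => //.
have d := @is_derive1_comp _ _ _ t _ _ (is_derive_climb r _ r0)
  (is_derive_reflect (2 * tau) t).
have := @is_deriveB _ _ _ (cst (2 * climb r tau)) _ t 1 _ _
  (is_derive_cst _ _ _) d.
by rewrite mulrN1 sub0r opprK.
Qed.

Lemma tent_continuous {R : realType} (tau r : R) : continuous (tent tau r).
Proof.
apply: switch_continuous; first by ring.
  exact: mulrl_continuous.
move=> t.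
exact: is_derive_continuous (@is_derive1_comp _ _ _ t _ _
  (is_derive_scale r _) (is_derive_reflect (2 * tau) t)).
Qed.

Lemma height_continuous {R : realType} (tau r : R) :
  r != 0 -> continuous (height tau r).
Proof.
move=> r0; apply: switch_continuous.
- by rewrite (_ : 2 * tau - tau = tau); ring.
- by move=> t; exact: is_derive_continuous (is_derive_climb r t r0).
move=> t; apply: cvgB; first exact: cvg_cst.
exact: is_derive_continuous (@is_derive1_comp _ _ _ t _ _
  (is_derive_climb r _ r0) (is_derive_reflect (2 * tau) t)).
Qed.

Lemma height_start {R : realType} (tau r : R) : 0 <= tau -> height tau r 0 = 0.
Proof.
have c0 : climb r 0 = 0 by rewrite /climb mulr0 expR0 subrr mul0r subr0.
rewrite /height /switch le_eqVlt => /predU1P[<-|->//].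
by rewrite ltxx c0 mulr0 subr0 c0 subr0.
Qed.

Lemma height_end {R : realType} (tau r : R) : 0 <= tau ->
  height tau r (2 * tau) = 2 * climb r tau.
Proof.
move=> tau0; rewrite /height /switch ifF; last first.
  by apply/negbTE; rewrite -leNgt; lra.
by rewrite subrr /climb mulr0 expR0 subrr mul0r !subr0.
Qed.

Lemma piecewise_constant_bang_bang {R : realType} (tau r : R) :
  piecewise_constant (bang_bang tau r).
Proof.
move=> a b ab; have [at_|ta] := ltP a tau; last first.
  exists [:: b]; split; first exact: itv_partition1.
  move=> [|//] _; exists (- r) => t; rewrite in_itv/= => /andP[at' _].
  by rewrite /bang_bang /switch ltNge (ltW (le_lt_trans ta at')).
have [tb|bt] := ltP tau b; last first.
  exists [:: b]; split; first exact: itv_partition1.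
  move=> [|//] _; exists r => t; rewrite in_itv/= => /andP[_ tb].
  by rewrite /bang_bang /switch (lt_le_trans tb bt).
exists [:: tau; b]; split; first by rewrite /itv_partition/= at_ tb eqxx.
move=> [|[|//]] _ /=.
  exists r => t; rewrite in_itv/= => /andP[_ tt].
  by rewrite /bang_bang /switch tt.
exists (- r) => t; rewrite in_itv/= => /andP[tt _].
by rewrite /bang_bang /switch ltNge (ltW tt).
Qed.

(** At [tau] the tent has a corner. The equation of motion only binds where the
    control is continuous, and this shows that [tau] is not such a time. *)
Lemma bang_bang_discontinuous {R : realType} (tau r : R) : r != 0 ->
  ~ {for tau, continuous (bang_bang tau r)}.
Proof.
move=> r0 /cvg_at_left_filter cl.
have cr : bang_bang tau r t @[t --> tau^'-] --> r.
  by apply: cvg_near_cst; near=> t; rewrite /bang_bang /switch ifT.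
have : bang_bang tau r tau = r.
  exact: (@cvg_unique _ (@Rhausdorff R) _ _ _ _ cl cr).
rewrite /bang_bang /switch ltxx => rr.
by move/eqP: r0; apply; lra.
Unshelve. all: by end_near. Qed.

Lemma bang_bang_continuous_neq {R : realType} (tau r t : R) : r != 0 ->
  {for t, continuous (bang_bang tau r)} -> t != tau.
Proof.
move=> r0 cu; apply/eqP => tt; apply: (bang_bang_discontinuous tau r r0).
by rewrite tt in cu.
Qed.

Lemma bang_bang_admissible {R : realType} (rho tau r : R) : `|r| <= rho ->
  admissible_control rho (bang_bang tau r).
Proof.
move=> rrho; split; first exact: piecewise_constant_bang_bang.
move: rrho; rewrite ler_norml => /andP[h1 h2] t.
by rewrite in_itv/= /bang_bang /switch; case: ifP => _; lra.
Qed.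

Lemma bang_bang_trajectory {R : realType} (rho tau r : R) :
  0 < tau -> r != 0 -> `|r| <= rho ->
  trajectory rho (0, circle_class 0) (0, circle_class (2 * climb r tau)) (2 * tau)
    (fun t => (tent tau r t, circle_class (height tau r t))).
Proof.
move=> tau0 r0 rrho; split; first lra.
  rewrite height_end; last exact: ltW.
  by rewrite /tent /switch ifF ?subrr ?mulr0//; apply/negbTE; rewrite -leNgt; lra.
exists (bang_bang tau r); first exact: bang_bang_admissible.
split.
- move=> t; apply: (@cvg_pair _ _ _ (nbhs t) (nbhs (tent tau r t))
    (nbhs (circle_class (height tau r t))) _ _ _ (tent tau r)
    (fun s => circle_class (height tau r s))).
    exact: tent_continuous.
  apply: (@continuous_comp _ _ _ (height tau r)); first exact: height_continuous.
  exact: pi_continuous.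
- by rewrite height_start ?(ltW tau0)// /tent /switch tau0 mulr0.
move=> t cu.
have ttau := bang_bang_continuous_neq tau r t r0 cu.
split; first exact: is_derive_tent.
exists (height tau r); split; last exact: is_derive_height.
by apply: (@nearW _ (nbhs t)) => s.
Qed.

(** * Extremality of the bang-bang trajectories *)

Lemma speed_bound {R : realType} (rho : R) (P : cylinder R) (u : R -> R)
    (c : R -> cylinder R) (a b : R) :
  admissible_control rho u -> solution_curve P u c -> a <= b ->
  `|(c b).1 - (c a).1| <= rho * (b - a).
Proof.
move=> [pu urho] [cc _ dc] ab.
have cx : continuous (fun t => (c t).1).
  by move=> t; apply: continuous_comp; [exact: cc | exact: cvg_fst].
have crho : continuous (fun t => rho * t) by exact: mulrl_continuous.
have hD : rho * a - (c a).1 <= rho * b - (c b).1.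
  apply: (le_piecewise_constant u (fun t => rho * t - (c t).1) a b) => //.
    by move=> t _; apply: cvgB; [exact: crho|exact: cx].
  move=> t _ cu; have [/= d _] := dc t cu.
  exists (rho - u t); first exact: (is_deriveB (is_derive_scale rho t) d).
  by have := urho t; rewrite in_itv/= subr_ge0 => /andP[].
have hS : rho * a + (c a).1 <= rho * b + (c b).1.
  apply: (le_piecewise_constant u (fun t => rho * t + (c t).1) a b) => //.
    by move=> t _; apply: cvgD; [exact: crho|exact: cx].
  move=> t _ cu; have [/= d _] := dc t cu.
  exists (rho + u t); first exact: (is_deriveD (is_derive_scale rho t) d).
  by have := urho t; rewrite in_itv/= => /andP[h _]; lra.
by rewrite ler_norml; apply/andP; split; lra.
Qed.

Lemma le_displacement {R : realType} (u x w Y Z : R -> R) (a b : R) :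
  piecewise_constant u -> a <= b ->
  (forall t : R, a <= t <= b -> {for t, continuous Y} /\ {for t, continuous Z}) ->
  (forall t : R, a < t < b -> {for t, continuous u} ->
    [/\ is_derive t (1 : R) Y (expR (x t) - 1),
        is_derive t (1 : R) Z (expR (w t) - 1) & x t <= w t]) ->
  Y b - Y a <= Z b - Z a.
Proof.
move=> pu ab cYZ dYZ.
suff : Z a - Y a <= Z b - Y b by lra.
apply: (le_piecewise_constant u (fun t => Z t - Y t)) => //.
  by move=> t /cYZ[cY cZ]; apply: cvgB.
move=> t tab /(dYZ t tab)[dY dZ xw].
exists ((expR (w t) - 1) - (expR (x t) - 1)); first exact: (is_deriveB dZ dY).
by rewrite opprB addrA subrK subr_ge0 ler_expR.
Qed.

(** As e^x is increasing in x, whoever stays below the tent gains less than the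
    bang-bang trajectory that follows it. *)
Lemma displacement_le_bang_bang {R : realType} (tau r : R) (x Y : R -> R) :
  r != 0 -> 0 <= tau ->
  (forall t : R, 0 <= t <= 2 * tau -> is_derive t (1 : R) Y (expR (x t) - 1)) ->
  (forall t : R, 0 <= t <= 2 * tau -> x t <= tent tau r t) ->
  Y (2 * tau) - Y 0 <= 2 * climb r tau.
Proof.
move=> r0 tau0 dY xtent.
have := le_displacement (bang_bang tau r) x (tent tau r) Y (height tau r)
  0 (2 * tau).
rewrite height_end// height_start// subr0; apply.
- exact: piecewise_constant_bang_bang.
- lra.
- move=> t tT; split; last exact: height_continuous.
  exact: is_derive_continuous (dY t tT).
move=> t /andP[t0 tT] cu.
have tI : 0 <= t <= 2 * tau by rewrite !ltW.
split; [exact: dY| |exact: xtent].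
exact: is_derive_height (bang_bang_continuous_neq tau r t r0 cu).
Qed.

Lemma bang_bang_le_displacement {R : realType} (tau r : R) (x Y : R -> R) :
  r != 0 -> 0 <= tau ->
  (forall t : R, 0 <= t <= 2 * tau -> is_derive t (1 : R) Y (expR (x t) - 1)) ->
  (forall t : R, 0 <= t <= 2 * tau -> tent tau r t <= x t) ->
  2 * climb r tau <= Y (2 * tau) - Y 0.
Proof.
move=> r0 tau0 dY tentx.
have := le_displacement (bang_bang tau r) (tent tau r) x (height tau r) Y
  0 (2 * tau).
rewrite height_end// height_start// subr0; apply.
- exact: piecewise_constant_bang_bang.
- lra.
- move=> t tT; split; first exact: height_continuous.
  exact: is_derive_continuous (dY t tT).
move=> t /andP[t0 tT] cu.
have tI : 0 <= t <= 2 * tau by rewrite !ltW.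
split; [|exact: dY|exact: tentx].
exact: is_derive_height (bang_bang_continuous_neq tau r t r0 cu).
Qed.

(** Here [r * climb r t] is e^(r t) - 1 - r t, and e^z - z is strictly monotone
    on each side of 0, increasing with |z|. The factor [r] lets one statement
    cover the rising ([r > 0]) and the falling ([r < 0]) climbs. *)
Lemma lt_climb {R : realType} (r s t : R) : 0 <= s -> s < t -> r != 0 ->
  r * climb r s < r * climb r t.
Proof.
move=> s0 st r0.
have climbE y : r * climb r y = expR (r * y) - 1 - r * y.
  by rewrite /climb; field.
rewrite !climbE.
have -> : r * t = r * s + r * (t - s) by ring.
rewrite expRD.
have rts : r * (t - s) != 0 by rewrite mulf_neq0// subr_eq0 gt_eqF.
have h1 := expR_gt1Dx rts.
have h2 := expR_gt0 (r * s).
(* For r > 0 the factor expR (r * s) is >= 1 and r * (t - s) > 0; for r < 0 both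
   comparisons are reversed. *)
have h3 : r * (t - s) <= expR (r * s) * (r * (t - s)).
  rewrite -subr_ge0 -[X in _ - X]mul1r -mulrBl.
  have [rp|rn|/eqP] := ltgtP r 0; last by rewrite (negbTE r0).
    apply: mulr_le0; first by rewrite subr_le0 -expR0 ler_expR nmulr_rle0.
    by rewrite nmulr_rle0// subr_ge0 ltW.
  apply: mulr_ge0; first by rewrite subr_ge0 -expR0 ler_expR pmulr_rge0.
  by rewrite pmulr_rge0// subr_ge0 ltW.
have : expR (r * s) * (1 + r * (t - s)) < expR (r * s) * expR (r * (t - s)).
  by rewrite ltr_pM2l.
rewrite mulrDr mulr1; lra.
Qed.

(** The left-hand side is 2 (e^(rho t) + e^(- rho t) - 2) / rho at t = tau; it
    vanishes at t = 0 and is continuous and unbounded. *)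
Lemma exists_half_time {R : realType} (rho : R) : 0 < rho ->
  exists2 tau : R, 0 < tau & 2 * climb rho tau - 2 * climb (- rho) tau = 1.
Proof.
move=> rho0.
have gapE t : 2 * climb rho t - 2 * climb (- rho) t =
    2 * (expR (rho * t) + expR (- (rho * t)) - 2) / rho.
  by rewrite /climb mulNr; field; rewrite gt_eqF.
pose f t : R := 2 * climb rho t - 2 * climb (- rho) t.
have f0 : f 0 = 0 by rewrite /f gapE mulr0 oppr0 expR0; ring.
(* Chosen so that the bound 1 + rho * b <= expR (rho * b) is 2 + rho / 2. *)
pose b := 1 / 2 + 1 / rho.
have b0 : 0 <= b by rewrite addr_ge0// divr_ge0// ltW.
have cf : continuous f.
  have cclimb r : r != 0 -> continuous (fun t => 2 * climb r t).
    move=> r0 t; apply: cvgM; first exact: cvg_cst.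
    exact: is_derive_continuous (is_derive_climb r t r0).
  by move=> t; apply: cvgB; apply: cclimb; rewrite ?oppr_eq0 gt_eqF.
have fb : 1 <= f b.
  rewrite /f gapE ler_pdivlMr// mul1r.
  have h1 := expR_ge1Dx (rho * b); have h2 := expR_gt0 (- (rho * b)).
  have h3 : rho * b = rho / 2 + 1 by rewrite /b; field; rewrite gt_eqF.
  lra.
have [] := @IVT R f 0 b 1 b0.
- exact: continuous_subspaceT.
- by rewrite f0 ge_min ler01 le_max fb orbT.
move=> t; rewrite in_itv/= => /andP[t0 _] ft; exists t => //.
rewrite lt_neqAle t0 andbT; apply/eqP => t0'.
by move: ft; rewrite -t0' f0 => /eqP; rewrite eq_sym oner_eq0.
Qed.

(** Leaving and re-entering x = 0 with speed at most [rho] keeps x between the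
    tents of slopes [- rho] and [rho], so that the lifted displacement [z] lies
    between those of the two bang-bang trajectories of the same duration. *)
Lemma reach_bound {R : realType} (rho y T : R) (c : R -> cylinder R) : 0 < rho ->
  trajectory rho (0, circle_class 0) (0, circle_class y) T c ->
  exists2 z, y - z \is a Num.int &
    2 * climb (- rho) (T / 2) <= z <= 2 * climb rho (T / 2).
Proof.
move=> rho0 [T0 cT [u au sc]].
have [cc c0 _] := sc.
have cx : continuous (fun t => (c t).1).
  by move=> t; apply: continuous_comp; [exact: cc | exact: cvg_fst].
have [|Y dY] := antiderivative (fun t => expR (c t).1 - 1) T.
  move=> t; apply: cvgB; last exact: cvg_cst.
  apply: (@continuous_comp _ _ _ (fun t => (c t).1)); first exact: cx.
  exact: continuous_expR.
pose Z t := Y t - Y 0.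
have dZ t : 0 <= t <= T -> is_derive t (1 : R) Z (expR (c t).1 - 1).
  move=> tT; have := is_deriveB (dY t tT) (is_derive_cst (Y 0) t (1 : R)).
  by rewrite subr0.
exists (Z T).
  apply/circle_classP.
  by rewrite -(solution_curve_lift _ u Z c T au.1 sc T0 dZ) /Z ?subrr// cT.
have TE : 2 * (T / 2) = T by field.
have tau0 : 0 <= T / 2 by rewrite divr_ge0.
have bound (t : R) : 0 <= t <= T ->
    tent (T / 2) (- rho) t <= (c t).1 <= tent (T / 2) rho t.
  move=> /andP[t0 tT].
  have := speed_bound _ _ _ _ _ _ au sc t0.
  have := speed_bound _ _ _ _ _ _ au sc tT.
  rewrite c0 cT /= subr0 sub0r normrN !ler_norml subr0.
  move=> /andP[h1 h2] /andP[h3 h4].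
  rewrite /tent /switch TE.
  by case: (ltP t (T / 2)) => _ /=; apply/andP; split; lra.
have Z0 : Z 0 = 0 by rewrite /Z subrr.
apply/andP; split.
  have := @bang_bang_le_displacement _ (T / 2) (- rho) (fun t => (c t).1) Z.
  rewrite TE Z0 subr0; apply=> //; first by rewrite oppr_eq0 gt_eqF.
  by move=> t /bound/andP[].
have := @displacement_le_bang_bang _ (T / 2) rho (fun t => (c t).1) Z.
rewrite TE Z0 subr0; apply=> //; first by rewrite gt_eqF.
by move=> t /bound/andP[].
Qed.

(** * Two minimal-time trajectories *)

Theorem corollary4p4 (R : realType) (rho : R) (rho_gt0 : 0 < rho) :
  exists (P0 P1 : cylinder R) (T : R) (c1 c2 : R -> cylinder R),
    [/\ minimal_time_trajectory rho P0 P1 T c1,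
        minimal_time_trajectory rho P0 P1 T c2 &
        exists2 t : R, t \in `[0, T] & c1 t <> c2 t].
Proof.
have rho1 : rho != 0 by rewrite gt_eqF.
have nrho1 : - rho != 0 by rewrite oppr_eq0.
have [tau tau0 gap] := exists_half_time rho rho_gt0.
pose P1 : cylinder R := (0, circle_class (2 * climb rho tau)).
have P1E : P1 = (0, circle_class (2 * climb (- rho) tau)).
  congr pair; apply/circle_classP; rewrite gap; exact: rpred1.
have fastest T' c' : trajectory rho (0, circle_class 0) P1 T' c' -> 2 * tau <= T'.
  move=> tr; have [T0 _ _] := tr; rewrite leNgt; apply/negP => T'lt.
  have [z] := reach_bound rho _ T' c' rho_gt0 tr.
  have t0 : 0 <= T' / 2 by rewrite divr_ge0.
  have tlt : T' / 2 < tau by rewrite ltr_pdivrMr// mulrC.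
  have up : climb rho (T' / 2) < climb rho tau.
    by rewrite -(ltr_pM2l rho_gt0); exact: lt_climb.
  have lo : climb (- rho) tau < climb (- rho) (T' / 2).
    by rewrite -(ltr_nM2l (_ : - rho < 0)) ?oppr_lt0//; exact: lt_climb.
  (* Before time 2 * tau the interval of reachable heights lies strictly inside
     one of length 1 whose end points are the two lifts of P1. *)
  move=> /intrP[m mE] /andP[z1 z2].
  have m_gt0 : 0 < m%:~R :> R by rewrite -mE; lra.
  have m_lt1 : m%:~R < 1%:~R :> R by rewrite -mE; lra.
  by move: m_gt0 m_lt1; rewrite ltr0z ltr_int; lia.
exists (0, circle_class 0), P1, (2 * tau),
  (fun t => (tent tau rho t, circle_class (height tau rho t))),
  (fun t => (tent tau (- rho) t, circle_class (height tau (- rho) t))).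
split.
- split; last exact: fastest.
  by apply: bang_bang_trajectory => //; rewrite gtr0_norm.
- split; last exact: fastest.
  by rewrite P1E; apply: bang_bang_trajectory => //; rewrite normrN gtr0_norm.
exists tau; first by rewrite in_itv/=; lra.
move=> [+ _]; rewrite /tent /switch ltxx => h.
have : rho * tau = 0 by lra.
by move=> /eqP; rewrite mulf_eq0 (negbTE rho1) gt_eqF.
Qed.
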